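(* Let $c_1,c_2\in\mathbb{C}$, let $r_1,r_2\in\mathbb{C}$ be the roots of $x^2+c_1x+c_2=0$ with $r_1\neq r_2$, and let $p_1=-c_1/2=(r_1+r_2)/2$. Suppose that a line of the form $L_1=\{p_1+t\,e^{i\theta^*}:t\in\mathbb{R}\}$ with $\theta^*\in\mathbb{R}$ satisfies $L_1\subset\mathbb{C}\setminus\{0\}$ and contains $r_1$ and $r_2$. Then $$\angle\, 0\,p_1\,r_1=\angle\, r_1\,p_1\,(c_2/p_1).$$
   Context: For points $a,b,d\in\mathbb{C}$ with $a\neq b$ and $d\neq b$, $\angle\, a\,b\,d$ denotes the angle at the vertex $b$ formed by the segments $\overline{ba}$ and $\overline{bd}$ in the plane $\mathbb{C}\cong\mathbb{R}^2$ (the usual unoriented angle in $[0,\pi]$). *)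

(* Defs.v *)
(* Stdlib reals with Coquelicot's complex numbers. *)
From Stdlib Require Import Reals.
From Coquelicot Require Import Coquelicot.

Local Open Scope R_scope.

(* e^{i theta}; Coquelicot has no complex exponential. *)
Definition expi (theta : R) : C := (cos theta, sin theta).

Definition line (p : C) (theta : R) (z : C) : Prop :=
  exists t : R, z = (p + RtoC t * expi theta)%C.

(* Standard inner product on C = R^2. *)
Definition dot (u v : C) : R := Re u * Re v + Im u * Im v.

(* Unoriented angle at the vertex b, in [0, PI]; meaningful only when
   a <> b and d <> b. *)
Definition angle (a b d : C) : R :=
  acos (dot (a - b)%C (d - b)%C / (Cmod (a - b)%C * Cmod (d - b)%C)).

(* Main.v *)
Require Import Defs.
From Stdlib Require Import Reals Lra.
From Coquelicot Require Import Coquelicot.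

Local Open Scope C_scope.

(** With [d = r1 - p1], completing the square gives [c2 = p1^2 - d^2], hence
    [c2 / p1 - p1 = -d^2 / p1].  Multiplication by [- d / p1] therefore sends
    the two sides [-p1], [d] of the first angle to the two sides [d], [-d^2/p1]
    of the second, and a complex similarity preserves angles. *)

(** [dot u v] is the real part of [u] times the conjugate of [v], so [k] enters only through its
    product with its own conjugate. *)
Lemma dot_Cmult (k u v : C) : dot (k * u) (k * v) = (Cmod k ^ 2 * dot u v)%R.
Proof.
rewrite Cmod2_alt; destruct k, u, v; unfold dot; simpl; ring.
Qed.

(** The inner product and the product of the moduli both scale by [Cmod k ^ 2], which cancels in the
    argument of [acos]. *)
Lemma angle_similarity (k a b d a' b' d' : C) :
  k <> 0 -> a' - b' = k * (a - b) -> d' - b' = k * (d - b) ->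
  angle a' b' d' = angle a b d.
Proof.
intros k0 Ha Hd; unfold angle.
rewrite Ha, Hd, dot_Cmult, !Cmod_mult.
assert (Hk : Cmod k <> 0%R) by (apply Rgt_not_eq, Cmod_gt_0, k0).
f_equal.
replace (Cmod k * Cmod (a - b) * (Cmod k * Cmod (d - b)))%R
  with (Cmod k ^ 2 * (Cmod (a - b) * Cmod (d - b)))%R by ring.
apply Rdiv_mult_l_l, pow_nonzero, Hk.
Qed.

Lemma quadratic_root_center (c1 c2 r p : C) :
  r ^ 2 + c1 * r + c2 = 0 -> p = - c1 / 2 -> c2 = p ^ 2 - (r - p) ^ 2.
Proof.
intros root Hp.
assert (two0 : RtoC 2 <> 0) by (intro H; apply RtoC_inj in H; lra).
assert (Hc1 : c1 = - (2 * p)) by (rewrite Hp; field; exact two0).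
assert (Hc2 : c2 = - (r ^ 2 + c1 * r)).
{ transitivity ((r ^ 2 + c1 * r + c2) - (r ^ 2 + c1 * r)); [ring |].
  rewrite root; ring. }
rewrite Hc2, Hc1; ring.
Qed.

Theorem mainTheorem2 (c1 c2 r1 r2 p1 : C) (theta : R)
  (root1 : r1 ^ 2 + c1 * r1 + c2 = RtoC 0)
  (root2 : r2 ^ 2 + c1 * r2 + c2 = RtoC 0)
  (r1_neq_r2 : r1 <> r2)
  (p1_def : p1 = - c1 / RtoC 2)
  (line_avoids_0 : forall z : C, line p1 theta z -> z <> RtoC 0)
  (r1_on_line : line p1 theta r1)
  (r2_on_line : line p1 theta r2) :
  angle (RtoC 0) p1 r1 = angle r1 p1 (c2 / p1).
Proof.
(* The center is the point of the line with parameter [t = 0]. *)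
assert (p0 : p1 <> 0).
{ apply line_avoids_0; exists 0%R; ring. }
pose proof (quadratic_root_center _ _ _ _ root1 p1_def) as Hc2.
pose proof (quadratic_root_center _ _ _ _ root2 p1_def) as Hc2'.
(* If [r1 = p1], the two expressions for [c2] give [(r2 - p1) ^ 2 = 0], so the roots coincide. *)
assert (d0 : r1 - p1 <> 0).
{ intro d0.
  assert (sq0 : (r2 - p1) * (r2 - p1) = 0).
  { transitivity ((r1 - p1) ^ 2 + (p1 ^ 2 - (r1 - p1) ^ 2)
                  - (p1 ^ 2 - (r2 - p1) ^ 2)); [ring |].
    rewrite <- Hc2, <- Hc2', d0; ring. }
  assert (r2 - p1 = 0) as d2.
  { destruct (Ceq_dec (r2 - p1) 0) as [e | n]; [exact e |].
    destruct (Cmult_neq_0 _ _ n n sq0). }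
  apply r1_neq_r2.
  transitivity (r1 - p1 + p1); [ring |].
  rewrite d0, <- d2; ring. }
(* After [symmetry], the second angle is the image of the first. *)
symmetry; apply (angle_similarity (- (r1 - p1) / p1)).
- intro k0; apply d0.
  transitivity (- (- (r1 - p1) / p1) * p1); [field; exact p0 |].
  rewrite k0; ring.
- field; exact p0.
- rewrite Hc2; field; exact p0.
Qed.
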